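(* Let $\overline{A_1A_2A_3}$ be a triangle in the Euclidean plane $\mathbb{R}^2$ with quadrances $Q_1=Q(A_2,A_3)$, $Q_2=Q(A_1,A_3)$ and $Q_3=Q(A_1,A_2)$, and let $\mathrm{area}$ denote its area. Then $$16\,\mathrm{area}^{2}=\left(Q_1+Q_2+Q_3\right)^{2}-2\left(Q_1^{2}+Q_2^{2}+Q_3^{2}\right).$$
   Context: The quadrance between points $A=[x_1,y_1]$ and $B=[x_2,y_2]$ of the real Euclidean plane is $Q(A,B)=(x_2-x_1)^2+(y_2-y_1)^2$. A triangle $\overline{A_1A_2A_3}$ is given by three non-collinear points $A_1,A_2,A_3$. *)

(* Defs.v *)
From HB Require Import structures.
From mathcomp Require Import all_boot all_order all_algebra.
From mathcomp Require Import all_classical all_reals all_analysis.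

Set Implicit Arguments.
Unset Strict Implicit.
Unset Printing Implicit Defensive.

Import Order.TTheory GRing.Theory Num.Theory.
Import numFieldNormedType.Exports.

Local Open Scope classical_set_scope.
Local Open Scope ring_scope.

Definition quadrance (R : realType) (A B : R * R) : R :=
  (B.1 - A.1) ^+ 2 + (B.2 - A.2) ^+ 2.

Definition collinear (R : realType) (A B C : R * R) : Prop :=
  exists a b c : R, (a, b) <> (0, 0) /\
    forall P, [\/ P = A, P = B | P = C] -> a * P.1 + b * P.2 + c = 0.

(* The filled triangle: the convex hull of its three vertices. *)
Definition triangle_region (R : realType) (A B C : R * R) : set (R * R) :=
  [set P | exists a b c : R, [/\ 0 <= a, 0 <= b, 0 <= c, a + b + c = 1 &
     P = (a * A.1 + b * B.1 + c * C.1, a * A.2 + b * B.2 + c * C.2)]].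

(* [\x] is the planar Lebesgue measure.  The region is compact, so its measure
   is finite and [fine] loses nothing. *)
Definition triangle_area (R : realType) (A B C : R * R) : R :=
  fine ((@lebesgue_measure R \x @lebesgue_measure R)%E (triangle_region A B C)).

(* Main.v *)
Require Import Defs.
From HB Require Import structures.
From mathcomp Require Import all_boot all_order all_algebra.
From mathcomp Require Import all_classical all_reals all_analysis.
From mathcomp Require Import measurable_realfun ring lra.

Import Order.TTheory GRing.Theory Num.Theory.
Import numFieldNormedType.Exports.
Local Open Scope classical_set_scope.
Local Open Scope ring_scope.

(** The right-hand side is Heron's formula written in quadrances: expanding it
    in coordinates gives 4 * (cross A1 A2 A3)^2.  So everything rests on
    area = |cross A1 A2 A3| / 2 for the Lebesgue measure of the filled triangle
    ([triangle_areaE]).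

    The product measure integrates the length of the vertical chords of the
    triangle.  Name the vertices so that A.1 <= B.1 <= C.1; neither the region
    nor |cross| depends on their order.  The chord through B is the longest
    one, of length |cross| / (C.1 - A.1), and by similarity the chord at
    abscissa x shrinks linearly to 0 as x goes from B.1 to A.1 or to C.1.
    The integral over [A.1, B.1] is then the area of a right triangle of width
    B.1 - A.1, the one over [B.1, C.1] of a right triangle of width C.1 - B.1,
    and the widths add up to C.1 - A.1.

    The two halves are handled by a single chord computation
    ([lebesgue_measure_xsection_triangle]), read once from the vertex A and once
    from C, and a single integral of an affine function ([integral_affine]).
    The triangle must be measurable so that the integral of the
    chord length can be split at B.1; for this it is written as an intersection
    of three half-planes ([triangle_region_cross]). *)

(** * The cross product and the triangle as an intersection of half-planes *)

Definition cross {R : realType} (A B C : R * R) : R :=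
  (B.1 - A.1) * (C.2 - A.2) - (C.1 - A.1) * (B.2 - A.2).

(** If the cross product vanishes, B - A and C - A are both multiples of one
    nonzero vector U: the first of them that is nonzero, or (1, 0) when the
    three points coincide.  The line through A directed by U contains all
    three. *)
Lemma cross_neq0 {R : realType} (A B C : R * R) :
  ~ collinear A B C -> cross A B C != 0.
Proof.
move=> ncol; apply/eqP => D0; apply: ncol.
have pair_neq0 (u v : R) : u != 0 \/ v != 0 -> (u, v) <> (0, 0).
  by move=> uv [u0 v0]; move: uv; rewrite u0 v0 eqxx => -[].
have line (U : R * R) : U.1 != 0 \/ U.2 != 0 ->
    U.1 * (B.2 - A.2) = U.2 * (B.1 - A.1) ->
    U.1 * (C.2 - A.2) = U.2 * (C.1 - A.1) -> collinear A B C.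
  move=> U0 UB UC; exists U.2, (- U.1), (U.1 * A.2 - U.2 * A.1); split.
    by apply: pair_neq0; rewrite oppr_eq0; case: U0; [right|left].
  by move=> P [] ->; lra.
rewrite /cross in D0.
have [B1|B1] := eqVneq (B.1 - A.1) 0; last first.
  by apply: (line (B.1 - A.1, B.2 - A.2)) => /=; [left| |]; lra.
have [B2|B2] := eqVneq (B.2 - A.2) 0; last first.
  by apply: (line (B.1 - A.1, B.2 - A.2)) => /=; [right| |]; lra.
have [C1|C1] := eqVneq (C.1 - A.1) 0; last first.
  by apply: (line (C.1 - A.1, C.2 - A.2)) => /=;
    [left| |]; rewrite ?B1 ?B2; lra.
have [C2|C2] := eqVneq (C.2 - A.2) 0; last first.
  by apply: (line (C.1 - A.1, C.2 - A.2)) => /=;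
    [right| |]; rewrite ?B1 ?B2; lra.
by apply: (line (1, 0)) => /=; [left; exact: oner_neq0| |]; lra.
Qed.

Lemma triangle_regionC12 {R : realType} (A B C : R * R) :
  triangle_region A B C = triangle_region B A C.
Proof.
by apply/seteqP; split=> P [a [b [c [? ? ? ? ->]]]]; exists b, a, c;
  split=> //; [lra|congr pair; lra|lra|congr pair; lra].
Qed.

Lemma triangle_regionC23 {R : realType} (A B C : R * R) :
  triangle_region A B C = triangle_region A C B.
Proof.
by apply/seteqP; split=> P [a [b [c [? ? ? ? ->]]]]; exists a, c, b;
  split=> //; [lra|congr pair; lra|lra|congr pair; lra].
Qed.

(** The three quotients are the barycentric coordinates of P, by Cramer's
    rule. *)
Lemma triangle_region_cross {R : realType} (A B C : R * R) :
  cross A B C != 0 ->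
  triangle_region A B C =
    [set P | 0 <= cross P B C / cross A B C] `&`
    [set P | 0 <= cross A P C / cross A B C] `&`
    [set P | 0 <= cross A B P / cross A B C].
Proof.
move=> D0; apply/seteqP; split=> P.
- move=> [a [b [c [a0 b0 c0 abc ->]]]].
  have ea : a = 1 - b - c by lra.
  split; [split|] => /=.
  + suff -> : cross (a * A.1 + b * B.1 + c * C.1, a * A.2 + b * B.2 + c * C.2)
        B C = a * cross A B C by rewrite mulfK.
    by rewrite ea /cross/=; ring.
  + suff -> : cross A (a * A.1 + b * B.1 + c * C.1,
        a * A.2 + b * B.2 + c * C.2) C = b * cross A B C by rewrite mulfK.
    by rewrite ea /cross/=; ring.
  + suff -> : cross A B (a * A.1 + b * B.1 + c * C.1,
        a * A.2 + b * B.2 + c * C.2) = c * cross A B C by rewrite mulfK.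
    by rewrite ea /cross/=; ring.
- move=> [[/= a0 b0] c0]; exists (cross P B C / cross A B C),
    (cross A P C / cross A B C), (cross A B P / cross A B C).
  case: P a0 b0 c0 => x y a0 b0 c0.
  rewrite {}/cross/= in D0 a0 b0 c0 *.
  by split=> //; [field|congr pair; field].
Qed.

Lemma measurable_triangle_region {R : realType} (A B C : R * R) :
  cross A B C != 0 ->
  measurable (triangle_region A B C :
    set (measurableTypeR R * measurableTypeR R)).
Proof.
move=> D0; rewrite triangle_region_cross//.
have mge0 (f : measurableTypeR R * measurableTypeR R -> R) :
    measurable_fun setT f -> measurable [set P | 0 <= f P].
  by move=> mf; rewrite -[X in measurable X]setTI; apply: measurable_fun_le.
pose meas (f : measurableTypeR R * measurableTypeR R -> R) :=
  measurable_fun setT f.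
have mfst : meas (fun P => P.1) by exact: measurable_fst.
have msnd : meas (fun P => P.2) by exact: measurable_snd.
have mcst (c : R) : meas (fun=> c) by exact: measurable_cst.
have mB f g : meas f -> meas g -> meas (fun P => f P - g P).
  exact: measurable_funB.
have mM f g : meas f -> meas g -> meas (fun P => f P * g P).
  exact: measurable_funM.
apply: measurableI; [apply: measurableI|]; apply: mge0; rewrite /cross;
  (apply: (mM); last exact: mcst); apply: (mB); apply: (mM); apply: (mB) => //;
  exact: mcst.
Qed.

(** * Lengths of the vertical chords *)

(** The chords come parametrized by a barycentric coordinate b; this form
    lets h have either sign, according to whether B is above or below
    the line AC. *)
Lemma lebesgue_measure_segment {R : realType} (p h s : R) : 0 <= s ->
  lebesgue_measure [set y | exists b, [/\ 0 <= b, b <= s & y = p + b * h]] =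
  (s * `|h|)%:E.
Proof.
move=> s0; have [h0|h0|->] := ltgtP h 0.
- rewrite [X in lebesgue_measure X](_ : _ = `[p + s * h, p]%classic).
    rewrite lebesgue_measure_itv/= lte_fin.
    have sh0 : s * h <= 0 by rewrite mulr_ge0_le0// ltW.
    by case: ltP => sh; rewrite ltr0_norm// -?EFinB; congr EFin; lra.
  apply/seteqP; split=> y /=; rewrite in_itv/=.
    by move=> [b [b0 bs ->]]; apply/andP; split; nra.
  move=> /andP[y1 y2]; exists ((y - p) / h).
  rewrite divfK ?lt_eqF// ler_ndivlMr// mul0r subr_le0 ler_ndivrMr//.
  by rewrite lerBrDl subrKC.
- rewrite [X in lebesgue_measure X](_ : _ = `[p, p + s * h]%classic).
    rewrite lebesgue_measure_itv/= lte_fin.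
    have sh0 : 0 <= s * h by rewrite mulr_ge0// ltW.
    by case: ltP => sh; rewrite gtr0_norm// -?EFinB; congr EFin; lra.
  apply/seteqP; split=> y /=; rewrite in_itv/=.
    by move=> [b [b0 bs ->]]; apply/andP; split; nra.
  move=> /andP[y1 y2]; exists ((y - p) / h).
  rewrite divfK ?gt_eqF// ler_pdivlMr// mul0r subr_ge0 ler_pdivrMr//.
  by rewrite lerBlDl subrKC.
- rewrite [X in lebesgue_measure X](_ : _ = [set p]).
    by rewrite lebesgue_measure_set1 normr0 mulr0.
  apply/seteqP; split=> y /=; first by move=> [b [_ _ ->]]; rewrite mulr0 addr0.
  by move=> ->; exists 0; split=> //; rewrite mulr0 addr0.
Qed.

(** When B.1 lies between A.1 and C.1, the chord at abscissa
    A.1 + s (B.1 - A.1) starts on the side AC and runs towards AB, in the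
    direction of the vertical vector from the line AC to B.  Matching
    abscissas gives b t + c = s t for the barycentric coordinates b and c of
    B and C, so c = t (s - b), and c >= 0 says exactly that b <= s.  The third
    coordinate 1 - b - t (s - b) >= 1 - s is then nonnegative for free. *)
Lemma xsection_triangle_region {R : realType} (A B C : R * R) (s t : R) :
  C.1 != A.1 -> 0 < t <= 1 -> B.1 - A.1 = t * (C.1 - A.1) -> 0 <= s <= 1 ->
  xsection (triangle_region A B C) (A.1 + s * (B.1 - A.1)) =
  [set y | exists b, [/\ 0 <= b, b <= s &
     y = A.2 + s * t * (C.2 - A.2) + b * (B.2 - A.2 - t * (C.2 - A.2))]].
Proof.
move=> CA /andP[t0 t1] Bt /andP[s0 s1].
have CA0 : C.1 - A.1 != 0 by rewrite subr_eq0.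
apply/seteqP; split=> y; rewrite /xsection/= inE.
- move=> [a [b [c [a0 b0 c0 abc [ex ->]]]]].
  have ea : a = 1 - b - c by lra.
  have ec : c = t * (s - b).
    apply: (mulIf CA0).
    have -> : c * (C.1 - A.1) = s * (B.1 - A.1) - b * (B.1 - A.1).
      by move: ex; rewrite ea; lra.
    by rewrite Bt; ring.
  exists b; split=> //; first by rewrite -subr_ge0 -(pmulr_rge0 _ t0) -ec.
  by rewrite ea ec; ring.
- move=> [b [b0 bs ->]]; exists (1 - b - t * (s - b)), b, (t * (s - b)).
  have B1 : B.1 = A.1 + t * (C.1 - A.1) by lra.
  have sb0 : 0 <= s - b by rewrite subr_ge0.
  have tsb0 : 0 <= t * (s - b) by rewrite mulr_ge0// ltW.
  have tsb1 : t * (s - b) <= s - b by rewrite ler_piMl.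
  split=> //; [lra|ring|congr pair; rewrite ?B1; ring].
Qed.

(** |cross A B C| / |C.1 - A.1| is the vertical distance from B to the line
    AC; the chord is the vertical segment from B to that line, shrunk by the
    homothety of centre A and ratio s.  No order is imposed between A.1 and
    C.1, so that A may be the leftmost or the rightmost vertex. *)
Lemma lebesgue_measure_xsection_triangle {R : realType} (A B C : R * R)
    (s : R) :
  B.1 != A.1 -> C.1 != A.1 -> 0 <= (B.1 - A.1) / (C.1 - A.1) <= 1 ->
  0 <= s <= 1 ->
  lebesgue_measure
    (xsection (triangle_region A B C) (A.1 + s * (B.1 - A.1))) =
  (s * (`|cross A B C| / `|C.1 - A.1|))%:E.
Proof.
move=> BA CA t01 s01.
have CA0 : C.1 - A.1 != 0 by rewrite subr_eq0.
have BA0 : B.1 - A.1 != 0 by rewrite subr_eq0.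
set t := (B.1 - A.1) / (C.1 - A.1) in t01.
rewrite (@xsection_triangle_region _ _ _ _ _ t)//; last 2 first.
- by rewrite lt_neqAle eq_sym mulf_neq0 ?invr_eq0.
- by rewrite divfK.
rewrite lebesgue_measure_segment; last by case/andP: s01.
congr (_ * _)%:E; rewrite -normf_div -normrN; congr `|_|.
by rewrite /t /cross; field.
Qed.

(** * Integrating the chord length *)

Lemma integral_affine {R : realType} (a b c k : R) : a <= b ->
  (\int[@lebesgue_measure R]_(x in `[a, b]) (k * (x - c))%:E =
   (k / 2 * ((b - c) ^+ 2 - (a - c) ^+ 2))%:E)%E.
Proof.
rewrite le_eqVlt => /predU1P[->|ab].
  by rewrite set_itv1 integral_set1 subrr mulr0.
pose F : R -> R := (k / 2) *: ((id - cst c) * (id - cst c)).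
have FE x : F x = k / 2 * (x - c) ^+ 2 by rewrite expr2.
have dF (x : R) : is_derive x 1 F (k * (x - c)).
  by rewrite /F; apply: is_derive_eq; rewrite /= /GRing.scale/= !fctE/=; field.
have cF : continuous F.
  by move=> x; apply/differentiable_continuous/derivable1_diffP/ex_derive.
rewrite (@continuous_FTC2 _ _ F)//.
- by rewrite -EFinB !FE -mulrBr.
- apply: continuous_subspaceT => x.
  by apply: cvgM; [exact: cvg_cst|apply: cvgB; [exact: cvg_id|exact: cvg_cst]].
- split; first by move=> x _; exact: ex_derive.
  + exact/cvg_at_right_filter/cF.
  + exact/cvg_at_left_filter/cF.
- by move=> x _; rewrite derive1E; apply: derive_val.
Qed.

(** Either of A.1 = B.1 and B.1 = C.1 is allowed: the corresponding half of
    the triangle then contributes an integral over a single point. *)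
Lemma triangle_area_sorted {R : realType} (A B C : R * R) :
  cross A B C != 0 -> A.1 <= B.1 -> B.1 <= C.1 ->
  triangle_area A B C = `|cross A B C| / 2.
Proof.
move=> D0 AB BC.
have AC : A.1 < C.1.
  rewrite lt_neqAle (le_trans AB BC) andbT; apply: contraNneq D0 => AC.
  have BA : B.1 = A.1 by apply/le_anti; rewrite AB AC BC.
  by rewrite /cross BA -AC !subrr !mul0r subrr.
have CA0 : C.1 - A.1 != 0 by rewrite subr_eq0 gt_eqF.
(* F x is the length of the chord at x, and m its value at B.1. *)
pose F (x : R) := lebesgue_measure (xsection (triangle_region A B C) x).
pose m := `|cross A B C| / (C.1 - A.1).
have mF : measurable_fun setT F.
  by apply: measurable_fun_xsection; exact: measurable_triangle_region.
have F0 x : x \notin `[A.1, C.1] -> F x = 0%E.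
  move=> xAC; rewrite /F [X in lebesgue_measure X](_ : _ = set0) ?measure0//.
  rewrite -subset0 => y; rewrite /xsection/= inE => -[a [b [c [a0 b0 c0 abc]]]].
  move=> [ex _]; move/negP: xAC; apply; rewrite in_itv/= ex.
  have -> : a = 1 - b - c by lra.
  by apply/andP; split; nra.
have FAB : (\int[lebesgue_measure]_(x in `[A.1, B.1]) F x =
            (m * (B.1 - A.1) / 2)%:E)%E.
  have [BA|BA] := eqVneq B.1 A.1.
    by rewrite BA set_itv1 integral_set1 subrr mulr0 mul0r.
  have BA0 : B.1 - A.1 != 0 by rewrite subr_eq0.
  have BAgt0 : 0 < B.1 - A.1 by rewrite lt_neqAle eq_sym BA0 subr_ge0.
  transitivity (\int[@lebesgue_measure R]_(x in `[A.1, B.1])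
      (m / (B.1 - A.1) * (x - A.1))%:E)%E; last first.
    by rewrite integral_affine//; congr EFin; field.
  apply: eq_integral => x; rewrite inE/= in_itv/= => /andP[Ax xB].
  have ex : x = A.1 + (x - A.1) / (B.1 - A.1) * (B.1 - A.1).
    by rewrite divfK// subrKC.
  rewrite /F {1}ex lebesgue_measure_xsection_triangle ?gt_eqF//.
  - rewrite /m (gtr0_norm (_ : 0 < C.1 - A.1)) ?subr_gt0//; congr EFin.
    by field; rewrite BA0 CA0.
  - by rewrite -subr_gt0.
  - by rewrite divr_ge0 ?subr_ge0 ?(ltW AC)// ler_pdivrMr ?subr_gt0//; lra.
  - by rewrite divr_ge0 ?subr_ge0//= ler_pdivrMr//; lra.
have FBC : (\int[lebesgue_measure]_(x in `[B.1, C.1]) F x =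
            (m * (C.1 - B.1) / 2)%:E)%E.
  have [BC'|BC'] := eqVneq B.1 C.1.
    by rewrite -BC' set_itv1 integral_set1 subrr mulr0 mul0r.
  have BC0 : B.1 - C.1 != 0 by rewrite subr_eq0.
  have CB0 : C.1 - B.1 != 0 by rewrite subr_eq0 eq_sym.
  have BClt0 : B.1 - C.1 < 0 by rewrite lt_neqAle BC0 subr_le0.
  transitivity (\int[@lebesgue_measure R]_(x in `[B.1, C.1])
      (m / (B.1 - C.1) * (x - C.1))%:E)%E; last first.
    by rewrite integral_affine//; congr EFin; field.
  apply: eq_integral => x; rewrite inE/= in_itv/= => /andP[Bx xC].
  have ex : x = C.1 + (x - C.1) / (B.1 - C.1) * (B.1 - C.1).
    by rewrite divfK// subrKC.
  have TE : triangle_region A B C = triangle_region C B A.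
    by rewrite triangle_regionC12 triangle_regionC23 triangle_regionC12.
  have DE : `|cross C B A| = `|cross A B C|.
    by rewrite -normrN; congr `|_|; rewrite /cross; ring.
  rewrite /F TE {1}ex lebesgue_measure_xsection_triangle ?lt_eqF//.
  - rewrite DE /m (ltr0_norm (_ : A.1 - C.1 < 0)) ?subr_lt0//; congr EFin.
    by field; rewrite BC0 CA0 -opprB oppr_eq0 CA0.
  - by rewrite -subr_lt0.
  - have AC0 : A.1 - C.1 < 0 by rewrite subr_lt0.
    by rewrite ler_ndivlMr// mul0r subr_le0 BC/= ler_ndivrMr//; lra.
  - by rewrite ler_ndivlMr// mul0r subr_le0 xC/= ler_ndivrMr//; lra.
rewrite /triangle_area /product_measure1.
rewrite (_ : integral _ _ _ =
  (\int[lebesgue_measure]_(x in `[A.1, C.1]) F x)%E);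
  last first.
  rewrite [RHS]integral_mkcond; apply: eq_integral => x _.
  rewrite patchE; case: ifPn => // xAC; apply: F0.
  by apply: contra xAC => xAC; rewrite inE.
rewrite (@itv_bndbnd_setU _ _ _ (BRight B.1)) ?bnd_simp//.
rewrite ge0_integral_setU//=.
- rewrite integral_itv_obnd_cbnd; last exact: measurable_funTS.
  by rewrite FAB FBC/= /m; field.
- exact: measurable_funTS.
- apply/disj_setPS => x [/=]; rewrite !in_itv/= => /andP[_ xB] /andP[Bx _].
  by move: (lt_le_trans Bx xB); rewrite ltxx.
Qed.

(** Two transpositions generate all orders of the vertices; each one
    preserves the region and changes the sign of the cross product. *)
Lemma triangle_areaE {R : realType} (A B C : R * R) :
  ~ collinear A B C -> triangle_area A B C = `|cross A B C| / 2.
Proof.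
move/cross_neq0.
have C12 (P Q S : R * R) : (cross P Q S != 0 ->
    triangle_area P Q S = `|cross P Q S| / 2) ->
    cross Q P S != 0 -> triangle_area Q P S = `|cross Q P S| / 2.
  have -> : cross Q P S = - cross P Q S by rewrite /cross; ring.
  by rewrite normrN oppr_eq0 /triangle_area triangle_regionC12.
have C23 (P Q S : R * R) : (cross P Q S != 0 ->
    triangle_area P Q S = `|cross P Q S| / 2) ->
    cross P S Q != 0 -> triangle_area P S Q = `|cross P S Q| / 2.
  have -> : cross P S Q = - cross P Q S by rewrite /cross; ring.
  by rewrite normrN oppr_eq0 /triangle_area triangle_regionC23.
wlog AB : A B / A.1 <= B.1 => [W|].
  have [|/ltW] := leP A.1 B.1; first exact: W.
  by move=> BA; apply: C12; exact: W.
have [BC|/ltW CB] := leP B.1 C.1.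
  by move=> D; exact: triangle_area_sorted.
apply: C23; have [AC|/ltW CA] := leP A.1 C.1.
  by move=> D; exact: triangle_area_sorted.
by apply: C12 => D; exact: triangle_area_sorted.
Qed.

Theorem theorem3 (R : realType) (A1 A2 A3 : R * R)
    (A123 : ~ collinear A1 A2 A3) :
  let Q1 := quadrance A2 A3 in
  let Q2 := quadrance A1 A3 in
  let Q3 := quadrance A1 A2 in
  let area := triangle_area A1 A2 A3 in
  16 * area ^+ 2 = (Q1 + Q2 + Q3) ^+ 2 - 2 * (Q1 ^+ 2 + Q2 ^+ 2 + Q3 ^+ 2).
Proof.
move=> Q1 Q2 Q3 area.
rewrite /area triangle_areaE// expr_div_n real_normK ?num_real//.
by rewrite /Q1 /Q2 /Q3 /quadrance /cross; field.
Qed.
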